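(* Consider the symmetric Markov process and the associated quantities described in the context (satisfying Assumptions (A), (B), (C), (D) and the ergodicity condition (E$_s$)). Define \[F(t)=\sum_{j=1}^{K(c+1)}\gamma_j\sum_{n_0=0}^\infty\sum_{m=0}^c\beta_{0,j}^{n_0}\,\omega_j(m)\,F_{n_0,m}(t),\qquad t\ge0.\] Then \[F(t)=\sum_{j=1}^{K(c+1)}\frac{\gamma_j\,\omega_j\mathbf 1}{1-\beta_{0,j}}\exp\Bigl(t\sum_{i=1}^K\Bigl(1-\frac{1}{\beta_{0,j}^{\,i}}\Bigr)\lambda_i\Bigr),\qquad t\ge0,\] where $\omega_j=(\omega_j(0),\dots,\omega_j(c))$ and $\mathbf 1$ is the column vector of $c+1$ ones.
   Context: Fix integers $c\ge1$, $K\ge1$. Consider an irreducible continuous-time Markov process on $V\cup W$, $V$ finite, $W=\{\mathbf n=(n_0,\dots,n_c): n_0\in\{0,1,\dots\},\ n_i\in\{0,1\}\}$, which is symmetric: there are nonnegative rates $a_k,b_k,c_k,d_k$ ($k\le K$ integer), the same for every $i$. From $\mathbf n\in W$, for each $i\in\{1,\dots,c\}$ and $k\in\{-n_0,\dots,K\}$, it jumps (changing only coordinates $0$ and $i$) from $(n_0,n_i)=(n_0,0)$ to $(n_0+k,1)$ at rate $a_k$ and to $(n_0+k,0)$ at rate $b_k$, and from $(n_0,1)$ to $(n_0+k,1)$ at rate $c_k$ and to $(n_0+k,0)$ at rate $d_k$; from $\mathbf n$ it jumps into $V$ with total rate $\sum_i\sum_{k\le-n_0-1}((1-n_i)(a_k+b_k)+n_i(c_k+d_k))$;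 no other transitions leave $W$; from $V$ no transitions go to states with $n_0\ge K$. Let $A(z)=\sum_{k\le K}a_kz^{K-k}$, similarly $B,C,D$; $F(z)=z^K(A(1)+B(1)-C(1)-D(1))-B(z)+C(z)$; for $|z|<1$ let $R(z)$ be a fixed square root of $F(z)^2+4A(z)D(z)$. Assumption (A): (i) $A(1),B(1),C(1),D(1)<\infty$; (ii) $A(1),D(1)>0$; (iii) $A'(1),B'(1),C'(1),D'(1)<\infty$; (iv) $a_K=0$ or $d_K=0$; (v) $b_K=c_K\ne0$. Ergodicity (E$_s$): $0<D(1)(A'(1)-KA(1)+B'(1)-KB(1))+A(1)(C'(1)-KC(1)+D'(1)-KD(1))$. For $\eta\in[-1,1]$ let $(\mathrm S_\eta)$ be the equation $\eta R(\beta_0)=B(\beta_0)+C(\beta_0)-\beta_0^K(A(1)+B(1)+C(1)+D(1))$. Assumptions (B),(C): for every $\eta\in\{(c-2k)/c:k=0,\dots,c\}$ and every root $\beta_0$ of $(\mathrm S_\eta)$ with $|\beta_0|<1$: $F(\beta_0)^2+4A(\beta_0)D(\beta_0)\ne0$ and $D(\beta_0)\ne0$. Aggregated representation: with $p$ the equilibrium distribution and $p(n_0,m)=\sum_{\mathbf n\in W:\ n_1+\dots+n_c=m}p(\mathbf n)$, let $(\eta^{(j)},\beta_{0,j})$, $j=1,\dots,K(c+1)$, be the pairs with $\eta^{(j)}\in\{(c-2k)/c:k=0,\dots,c\}$ and $\beta_{0,j}$ a root of $(\mathrm S_{\eta^{(j)}})$ with $|\beta_{0,j}|<1$; pick $x^{(j)}\in\{-1,1\}^c$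 with $-\frac1c\sum_ix^{(j)}_i=\eta^{(j)}$, let $\beta_{i,j}=(F(\beta_{0,j})+x^{(j)}_iR(\beta_{0,j}))/(2D(\beta_{0,j}))$ and $\omega_j(m)=\sum_{n_i\in\{0,1\},\,n_1+\dots+n_c=m}\prod_{i=1}^c\beta_{i,j}^{n_i}$. The constants $\gamma_j$ are the (complex) constants with $p(n_0,m)=\sum_{j=1}^{K(c+1)}\gamma_j\beta_{0,j}^{n_0}\omega_j(m)$ for all $n_0\ge0$, $m=0,\dots,c$. Level matrices: for integers $k\le K$ define $(c+1)\times(c+1)$ matrices $\Lambda_k$ indexed by $m,m'\in\{0,\dots,c\}$ with $\Lambda_k(m,m+1)=a_k(c-m)$, $\Lambda_k(m,m-1)=d_km$, $\Lambda_k(m,m)=b_k(c-m)+c_km$ for $k\ne0$, and for $k=0$ the same off-diagonal entries but $\Lambda_0(m,m)=b_0(c-m)+c_0m-\sum_{k\le K}\bigl((a_k+b_k)(c-m)+(c_k+d_k)m\bigr)$; all other entries $0$. Assumption (D): $\Lambda_i=\lambda_iI$ for $i=1,\dots,K$, for some $\lambda_i\ge0$. First passage: for $n_0\ge0$, $m\in\{0,\dots,c\}$, let $F_{n_0,m}(t)$ be the probability that the first passage time to $V$ exceeds $t$, for the aggregated process $(n_0,m)$ (where $m=n_1+\dots+n_c$) started at $(n_0,m)$ at time $0$ in which all transitions in the positive $n_0$-direction (those with rates $a_k,b_k,c_k,d_k$, $k>0$) are suppressed for $t\ge0$; equivalently, $F_{n_0}(t)=(F_{n_0,0}(t),\dots,F_{n_0,c}(t))^T$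 solves $F_{n_0}'(t)=\sum_{i=0}^K\Lambda_iF_{n_0}(t)+\sum_{k=1}^{n_0}\Lambda_{-k}F_{n_0-k}(t)$, $F_{n_0}(0)=\mathbf 1$. *)

(* Defs.v *)
From HB Require Import structures.
From mathcomp Require Import all_boot all_order all_algebra.
From mathcomp Require Import all_classical all_reals all_analysis.
From mathcomp Require Export complex.
Import Order.TTheory GRing.Theory Num.Theory.
Import numFieldNormedType.Exports.

Set Implicit Arguments.
Unset Strict Implicit.
Unset Printing Implicit Defensive.

Local Open Scope ring_scope.
Local Open Scope complex_scope.
Local Open Scope classical_set_scope.

HB.instance Definition _ (R : rcfType) := NormedModule.copy R[i] (R[i])^o.

Definition rser (R : realType) (u : nat -> R) : R := limn (series u).
Definition rsummable (R : realType) (u : nat -> R) : Prop := cvgn (series u).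
Definition cser (R : realType) (u : nat -> R[i]) : R[i] := limn (series u).
Definition csummable (R : realType) (u : nat -> R[i]) : Prop := cvgn (series u).

Definition cexp (R : realType) (z : R[i]) : R[i] :=
  (expR (complex.Re z))%:C * ((cos (complex.Im z)) +i* (sin (complex.Im z))).

Section Model.
Variable R : realType.
(* The rates a_k, b_k, c_k, d_k (only k <= K is relevant). *)
Variables (a b cr d : int -> R) (K : nat).

(** the sequence n |-> r_{K-n}, i.e. the coefficient of z^n in r's generating
    function *)
Definition coef (r : int -> R) (n : nat) : R := r (K%:Z - n%:Z).

Definition gen1 (r : int -> R) : R := rser (coef r).
Definition gend1 (r : int -> R) : R := rser (fun n => n%:R * coef r n).
Definition genz (r : int -> R) (z : R[i]) : R[i] :=
  cser (fun n => (coef r n)%:C * z ^+ n).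

Definition Ffun (z : R[i]) : R[i] :=
  z ^+ K * (gen1 a + gen1 b - gen1 cr - gen1 d)%:C - genz b z + genz cr z.

Definition assumptionA : Prop :=
  [/\
      [/\ rsummable (coef a), rsummable (coef b), rsummable (coef cr)
        & rsummable (coef d)],
      [/\ 0 < gen1 a & 0 < gen1 d],
      [/\ rsummable (fun n => n%:R * coef a n),
          rsummable (fun n => n%:R * coef b n),
          rsummable (fun n => n%:R * coef cr n) &
          rsummable (fun n => n%:R * coef d n)],
      a K%:Z = 0 \/ d K%:Z = 0 &
      [/\ b K%:Z = cr K%:Z & b K%:Z != 0]].

Definition ergodic_s : Prop :=
  0 < gen1 d * (gend1 a - K%:R * gen1 a + gend1 b - K%:R * gen1 b)
      + gen1 a * (gend1 cr - K%:R * gen1 cr + gend1 d - K%:R * gen1 d).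

Definition is_sqrt_branch (Rf : R[i] -> R[i]) : Prop :=
  forall z : R[i], `|z| < 1 ->
    Rf z ^+ 2 = Ffun z ^+ 2 + 4%:R * genz a z * genz d z.

Variable c : nat.

Definition eta_of (k : nat) : R := (c%:R - 2%:R * k%:R) / c%:R.

Definition Sroot (Rf : R[i] -> R[i]) (eta : R) (z : R[i]) : Prop :=
  `|z| < 1 /\
  eta%:C * Rf z = genz b z + genz cr z
                  - z ^+ K * (gen1 a + gen1 b + gen1 cr + gen1 d)%:C.

Definition assumptionBC (Rf : R[i] -> R[i]) : Prop :=
  forall (k : 'I_c.+1) (z : R[i]), Sroot Rf (eta_of k) z ->
    Ffun z ^+ 2 + 4%:R * genz a z * genz d z != 0 /\ genz d z != 0.

Definition beta_i (Rf : R[i] -> R[i]) (b0 : R[i]) (x : R) : R[i] :=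
  (Ffun b0 + x%:C * Rf b0) / (2%:R * genz d b0).

Definition omega (bet : 'I_c -> R[i]) (m : nat) : R[i] :=
  \sum_(n : {ffun 'I_c -> bool} | (\sum_(i < c) n i)%N == m)
     \prod_(i < c) bet i ^+ n i.

Definition Lam (k : int) : 'M[R]_(c.+1) :=
  \matrix_(m < c.+1, m' < c.+1)
    (if (m' == m.+1 :> nat) then a k * (c - m)%:R
     else if (m'.+1 == m :> nat) then d k * m%:R
     else if (m' == m :> nat) then
       b k * (c - m)%:R + cr k * m%:R
       - (if k == 0 then
            rser (fun n => (coef a n + coef b n) * (c - m)%:R
                           + (coef cr n + coef d n) * m%:R)
          else 0)
     else 0).

Definition assumptionD (lam : nat -> R) : Prop :=
  forall i : nat, (1 <= i <= K)%N -> Lam i%:Z = (lam i)%:M /\ 0 <= lam i.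

Definition Wstate := (nat * {ffun 'I_c -> bool})%type.

(** rate of the local jump (n_0, n_i) -> (n_0 + k, n_i') *)
Definition jrate (ni ni' : bool) (k : int) : R :=
  match ni, ni' with
  | false, true => a k | false, false => b k
  | true, true => cr k | true, false => d k end.

(** total rate from x to y (x != y) inside W: sum over the coordinates i
    whose transition (changing only coordinates 0 and i) leads from x to y *)
Definition WWrate (x y : Wstate) : R :=
  let k := (y.1)%:Z - (x.1)%:Z in
  if k <= K%:Z then
    \sum_(i < c)
      (if [forall i' : 'I_c, (i' != i) ==> (x.2 i' == y.2 i')]
       then jrate (x.2 i) (y.2 i) k else 0)
  else 0.

Definition WVrate (x : Wstate) : R :=
  \sum_(i < c) rser (fun l : nat =>
     let k := - (x.1)%:Z - 1 - l%:Z in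
     if x.2 i then cr k + d k else a k + b k).

Variable V : finType.
Definition State := (V + Wstate)%type.

Inductive reach (q : State -> State -> R) : State -> State -> Prop :=
| reach_refl x : reach q x x
| reach_step x y z : x != y -> 0 < q x y -> reach q y z -> reach q x z.

(** q x y (x != y) = transition rate from x to y *)
Definition sym_process (q : State -> State -> R) : Prop :=
  [/\ forall x y : State, x != y -> 0 <= q x y,
      forall x y : Wstate, x != y -> q (inr x) (inr y) = WWrate x y,
      forall x : Wstate, \sum_(v : V) q (inr x) (inl v) = WVrate x,
      forall (v : V) (y : Wstate), (K <= y.1)%N -> q (inl v) (inr y) = 0 &
      forall x y : State, reach q x y (* irreducibility *) ].

Definition ssummable (f : State -> R) : Prop :=
  rsummable (fun n0 => \sum_(n : {ffun 'I_c -> bool}) f (inr (n0, n))).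
Definition ssum (f : State -> R) : R :=
  \sum_(v : V) f (inl v)
  + rser (fun n0 => \sum_(n : {ffun 'I_c -> bool}) f (inr (n0, n))).

Definition equilibrium (q : State -> State -> R) (p : State -> R) : Prop :=
  [/\ forall x, 0 <= p x, ssummable p, ssum p = 1 &
      forall y : State,
        [/\ ssummable (fun x => if x == y then 0 else p x * q x y),
            ssummable (fun z => if z == y then 0 else q y z) &
            ssum (fun x => if x == y then 0 else p x * q x y)
            = p y * ssum (fun z => if z == y then 0 else q y z)]].

Definition pagg (p : State -> R) (n0 m : nat) : R :=
  \sum_(n : {ffun 'I_c -> bool} | (\sum_(i < c) n i)%N == m) p (inr (n0, n)).

(** First passage functions F_{n0,m}(t) (t >= 0): survival probabilities,
    i.e. the solution of
    F_{n0}' = sum_{i=0}^K Lam_i F_{n0} + sum_{k=1}^{n0} Lam_{-k} F_{n0-k},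
    F_{n0}(0) = 1. *)
Definition first_passage (Fs : nat -> 'I_c.+1 -> R -> R) : Prop :=
  [/\ forall n0 m, Fs n0 m 0 = 1,
      forall n0 m, Fs n0 m x @[x --> 0^'+] --> Fs n0 m 0,
      forall n0 m t, 0 <= t -> 0 <= Fs n0 m t <= 1 &
      forall n0 m t, 0 < t ->
        derivable (Fs n0 m) t 1 /\
        (Fs n0 m)^`() t =
          \sum_(m' < c.+1) (\sum_(0 <= i < K.+1) Lam i%:Z) m m' * Fs n0 m' t
          + \sum_(1 <= k < n0.+1)
              \sum_(m' < c.+1) Lam (- k%:Z) m m' * Fs (n0 - k)%N m' t].

End Model.

(* Main.v *)
(** The identity holds for each summand j separately. The vector omega_j annihilates
    sum_n beta^n Lambda_{K-n}: its generating function is prod_i (1 + beta_i X), and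
    the quadratic equation satisfied by the beta_i makes the generating function of
    the product a multiple of prod_i (1 + beta_i X), with a factor that vanishes by
    (S_eta). With Assumption (D), the partial sum S_N(t) of
    sum_n beta^n omega_j F_n(t) then satisfies S_N' - mu S_N = O(N |beta|^N)
    uniformly in t, where mu = sum_i (1 - beta^-i) lambda_i. The mean value theorem
    applied to S_N(t) exp(- mu t) gives both the convergence of the series at t and
    its value exp(mu t) S(0), without differentiating an infinite sum. *)
Require Import Defs.
From HB Require Import structures.
From mathcomp Require Import all_boot all_order all_algebra.
From mathcomp Require Import all_classical all_reals all_analysis.
From mathcomp Require Import complex.
From mathcomp Require Import ring lra zify.
Import Order.TTheory GRing.Theory Num.Theory.
Import numFieldNormedType.Exports.
Local Open Scope ring_scope.
Local Open Scope complex_scope.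
Local Open Scope classical_set_scope.

Set Implicit Arguments.
Unset Strict Implicit.
Unset Printing Implicit Defensive.

Import Normc.

(** * The real-valued modulus on [R[i]] *)

Lemma normr_normc (R : realType) (z : R[i]) : `|z| = (normc z)%:C.
Proof. by case: z. Qed.

Lemma normc_ge0 (R : realType) (z : R[i]) : 0 <= normc z.
Proof. by case: z => a b; rewrite sqrtr_ge0. Qed.

Lemma normc_real (R : realType) (r : R) : normc r%:C = `|r|.
Proof. by rewrite /= expr0n addr0 sqrtr_sqr. Qed.

Lemma normcX (R : realType) (z : R[i]) n : normc (z ^+ n) = normc z ^+ n.
Proof. by elim: n => [|n IH]; rewrite ?normc1 // !exprS normcM IH. Qed.

Lemma normc_sum (R : realType) (I : Type) (r : seq I) (P : pred I)
    (F : I -> R[i]) :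
  normc (\sum_(i <- r | P i) F i) <= \sum_(i <- r | P i) normc (F i).
Proof.
apply: (big_ind2 (fun z x => normc z <= x)) => // [|z1 x1 z2 x2 h1 h2].
  by rewrite normc0.
by apply: le_trans (le_normcD _ _) _; apply: lerD.
Qed.

Lemma Re_le_normc (R : realType) (z : R[i]) : `|complex.Re z| <= normc z.
Proof.
by case: z => a b /=; rewrite -sqrtr_sqr ler_sqrt ?lerDl ?sqr_ge0 ?addr_ge0 ?sqr_ge0.
Qed.

Lemma Im_le_normc (R : realType) (z : R[i]) : `|complex.Im z| <= normc z.
Proof.
by case: z => a b /=; rewrite -sqrtr_sqr ler_sqrt ?lerDr ?sqr_ge0 ?addr_ge0 ?sqr_ge0.
Qed.

Lemma normc_le_ReIm (R : realType) (z : R[i]) :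
  normc z <= `|complex.Re z| + `|complex.Im z|.
Proof.
case: z => a b /=.
have h : 0 <= `|a| + `|b| by rewrite addr_ge0.
rewrite -(ger0_norm h) -sqrtr_sqr ler_sqrt ?sqr_ge0 //.
by rewrite sqrrD !real_normK ?num_real // lerD2r lerDl mulrn_wge0 // mulr_ge0.
Qed.

Lemma Re_sum (R : realType) (I : Type) (r : seq I) (P : pred I)
    (F : I -> R[i]) :
  complex.Re (\sum_(i <- r | P i) F i) = \sum_(i <- r | P i) complex.Re (F i).
Proof.
by apply: (big_ind2 (fun z x => complex.Re z = x)) => // -[? ?] ? [? ?] ? /= -> ->.
Qed.

Lemma Im_sum (R : realType) (I : Type) (r : seq I) (P : pred I)
    (F : I -> R[i]) :
  complex.Im (\sum_(i <- r | P i) F i) = \sum_(i <- r | P i) complex.Im (F i).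
Proof.
by apply: (big_ind2 (fun z x => complex.Im z = x)) => // -[? ?] ? [? ?] ? /= -> ->.
Qed.

(** * Convergence of complex sequences *)

(** Phrased as a real limit of moduli, so that all estimates stay in [R]; [ctends_cvg] returns to
    the topology behind [cser]. *)
Definition ctends (R : realType) (u : nat -> R[i]) (l : R[i]) : Prop :=
  normc (u n - l) @[n --> \oo] --> (0 : R).

Lemma ctends_Re (R : realType) (u : nat -> R[i]) (l : R[i]) : ctends u l ->
  complex.Re (u n) @[n --> \oo] --> complex.Re l.
Proof.
move=> /cvgrPdist_lt h; apply/cvgrPdist_lt => e e0.
apply: filterS (h _ e0) => n; rewrite sub0r normrN (ger0_norm (normc_ge0 _)).
apply: le_lt_trans; apply: le_trans (Re_le_normc _).
by case: (u n) (l) => ? ? [? ?] /=; rewrite distrC.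
Qed.

Lemma ctends_Im (R : realType) (u : nat -> R[i]) (l : R[i]) : ctends u l ->
  complex.Im (u n) @[n --> \oo] --> complex.Im l.
Proof.
move=> /cvgrPdist_lt h; apply/cvgrPdist_lt => e e0.
apply: filterS (h _ e0) => n; rewrite sub0r normrN (ger0_norm (normc_ge0 _)).
apply: le_lt_trans; apply: le_trans (Im_le_normc _).
by case: (u n) (l) => ? ? [? ?] /=; rewrite distrC.
Qed.

Lemma ctends_ReIm (R : realType) (u : nat -> R[i]) (l : R[i]) :
  complex.Re (u n) @[n --> \oo] --> complex.Re l ->
  complex.Im (u n) @[n --> \oo] --> complex.Im l -> ctends u l.
Proof.
move=> /cvgrPdist_lt hr /cvgrPdist_lt hi; apply/cvgrPdist_lt => e e0.
have e20 : 0 < e / 2 by rewrite divr_gt0.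
near=> n; rewrite sub0r normrN (ger0_norm (normc_ge0 _)).
apply: le_lt_trans (normc_le_ReIm _) _.
have : `|complex.Re l - complex.Re (u n)| < e / 2 by near: n; exact: hr.
have : `|complex.Im l - complex.Im (u n)| < e / 2 by near: n; exact: hi.
rewrite distrC => h1; rewrite distrC => h2.
case: (u n) (l) h1 h2 => ? ? [? ?] /= h1 h2.
by rewrite [e]splitr; apply: ltrD.
Unshelve. all: by end_near. Qed.

Lemma numfield_cvg_lim (K : numFieldType) (u : nat -> K) (l : K) :
  u @ \oo --> l -> limn u = l.
Proof. by move=> h; apply/cvg_lim => //; exact: norm_hausdorff. Qed.

Lemma numfield_cvgP (K : numFieldType) (u : nat -> K) (l : K) :
  (forall e, 0 < e -> \forall n \near \oo, `|l - u n| < e) -> u @ \oo --> l.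
Proof. by move=> h; apply/cvgrPdist_lt. Qed.

Lemma ctends_cvg (R : realType) (u : nat -> R[i]) (l : R[i]) :
  ctends u l -> u @ \oo --> l.
Proof.
move=> /cvgrPdist_lt h; apply: (@numfield_cvgP R[i] u l) => e.
(* A positive element of [R[i]] has zero imaginary part, so the complex tolerance is a real one. *)
case: e => er ei; rewrite ltcE /= => /andP[/eqP -> e0].
apply: filterS (h _ e0) => n; rewrite sub0r normrN (ger0_norm (normc_ge0 _)).
by rewrite distrC normr_normc -[er +i* 0]/(er%:C) ltcR.
Qed.

Lemma ctends_cser (R : realType) (u : nat -> R[i]) (l : R[i]) :
  ctends (series u) l -> csummable u /\ cser u = l.
Proof.
move=> /ctends_cvg h; split; last exact: (@numfield_cvg_lim R[i] _ _ h).
by apply/cvg_ex; exists l.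
Qed.

Lemma eq_ctends (R : realType) (u v : nat -> R[i]) (l : R[i]) (N : nat) :
  (forall n, (N <= n)%N -> u n = v n) -> ctends u l -> ctends v l.
Proof.
move=> uv; apply: cvg_trans; apply: near_eq_cvg.
by exists N => //= n /uv ->.
Qed.

Lemma ctends_cst (R : realType) (l : R[i]) : ctends (fun=> l) l.
Proof. by rewrite /ctends subrr normc0; exact: cvg_cst. Qed.

Lemma ctendsD (R : realType) (u v : nat -> R[i]) (l k : R[i]) :
  ctends u l -> ctends v k -> ctends (fun n => u n + v n) (l + k).
Proof.
move=> hu hv.
have Re_add (y z : R[i]) : complex.Re (y + z) = complex.Re y + complex.Re z.
  by case: y z => ? ? [].
have Im_add (y z : R[i]) : complex.Im (y + z) = complex.Im y + complex.Im z.
  by case: y z => ? ? [].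
apply: ctends_ReIm.
  under eq_cvg do rewrite Re_add.
  by rewrite Re_add; apply: cvgD; exact: ctends_Re.
under eq_cvg do rewrite Im_add.
by rewrite Im_add; apply: cvgD; exact: ctends_Im.
Qed.

Lemma ctendsMl (R : realType) (u : nat -> R[i]) (l z : R[i]) :
  ctends u l -> ctends (fun n => z * u n) (z * l).
Proof.
move=> h; rewrite /ctends.
under eq_cvg do rewrite -mulrBr normcM.
have := @cvgMl_tmp R nat \oo _ _ (normc z : R) _ h.
by rewrite mulr0; exact.
Qed.

Lemma ctends_sum (R : realType) (I : Type) (r : seq I)
    (u : I -> nat -> R[i]) (l : I -> R[i]) :
  (forall i, ctends (u i) (l i)) ->
  ctends (fun n => \sum_(i <- r) u i n) (\sum_(i <- r) l i).
Proof.
move=> h; elim: r => [|i r IH].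
  rewrite big_nil; apply: (@eq_ctends _ _ _ _ 0%N) (ctends_cst 0) => n _.
  by rewrite big_nil.
rewrite big_cons; apply: (@eq_ctends _ _ _ _ 0%N) (ctendsD (h i) IH) => n _.
by rewrite big_cons.
Qed.

(** * Geometric domination of series and of their tails *)

Lemma cvg_series_geometric_bound (R : realType) (u : nat -> R) (B r : R) :
  0 <= r < 1 -> (forall n, `|u n| <= B * r ^+ n) -> cvgn (series u).
Proof.
move=> /andP[r0 r1] h; apply: normed_cvg.
apply: (@series_le_cvg _ _ (geometric B r)) => //= n.
  by apply: le_trans (h n).
by apply: is_cvg_geometric_series; rewrite ger0_norm.
Qed.

Lemma ctends_geometric_bound (R : realType) (u : nat -> R[i]) (B r : R) :
  0 <= r < 1 -> (forall n, normc (u n) <= B * r ^+ n) ->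
  ctends (series u) (cser u).
Proof.
move=> hr h.
have /cvg_ex[/= lr Hr] : cvgn (series (fun n => complex.Re (u n))).
  apply: (cvg_series_geometric_bound hr) => n.
  by apply: le_trans (Re_le_normc _) (h n).
have /cvg_ex[/= li Hi] : cvgn (series (fun n => complex.Im (u n))).
  apply: (cvg_series_geometric_bound hr) => n.
  by apply: le_trans (Im_le_normc _) (h n).
have H : ctends (series u) (lr +i* li).
  apply: ctends_ReIm => /=.
    apply: cvg_trans Hr; apply: near_eq_cvg; apply: nearW => n.
    by rewrite /series /= Re_sum.
  apply: cvg_trans Hi; apply: near_eq_cvg; apply: nearW => n.
  by rewrite /series /= Im_sum.
by have [_ ->] := ctends_cser H.
Qed.

(** As the sum is 0, a partial sum is minus the tail after it, and the geometric majorant bounds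
    that tail. The proof uses a finite block up to [n + N] plus a remainder below [e], and lets [e]
    go to 0. *)
Lemma series_tail_bound (R : realType) (u : nat -> R[i]) (B r : R) :
  0 <= r < 1 -> (forall n, normc (u n) <= B * r ^+ n) ->
  ctends (series u) 0 -> forall n, normc (series u n) <= B / (1 - r) * r ^+ n.
Proof.
move=> /andP[r0 r1] h /cvgrPdist_lt u0 n; apply/ler_addgt0Pr => e e0.
have r1' : 0 < 1 - r by rewrite subr_gt0.
have B0 : 0 <= B.
  by have := h 0; rewrite expr0 mulr1; apply: le_trans; exact: normc_ge0.
have geo k : \sum_(n <= i < n + k) B * r ^+ i
    = B / (1 - r) * r ^+ n * (1 - r ^+ k).
  elim: k => [|k IH]; first by rewrite addn0 big_geq // expr0 subrr mulr0.
  rewrite addnS big_nat_recr ?leq_addr //= IH exprD exprS.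
  by field; rewrite gt_eqF.
have [N _ /(_ (n + N)%N)] := u0 _ e0.
rewrite /= leq_addl subr0 sub0r normrN (ger0_norm (normc_ge0 _)) => /(_ isT) hN.
have -> : series u n = series u (n + N)%N - \sum_(n <= i < n + N) u i.
  by rewrite /series /= (@big_cat_nat _ _ _ n 0 (n + N)) ?leq_addr //= addrK.
apply: le_trans (le_normcD _ _) _; rewrite normcN addrC; apply: lerD; last exact: ltW.
apply: le_trans (normc_sum _ _ _) _.
apply: le_trans (ler_sum _ _) _; first by move=> i _; exact: h.
rewrite geo ler_piMr ?gerBl ?exprn_ge0 //.
by rewrite mulr_ge0 ?exprn_ge0 // divr_ge0 // ltW.
Qed.

(** With [s] the square root of [r], a Bernoulli inequality bounds [n * s ^ n], and the remaining
    factor [s ^ n] tends to 0. *)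
Lemma cvg_linear_geometric (R : realType) (r C : R) : 0 <= r < 1 ->
  C * n%:R * r ^+ n @[n --> \oo] --> (0 : R).
Proof.
move=> /andP[r0 r1].
have [->|rn0] := eqVneq r 0.
  apply: cvg_near_cst; exists 1%N => //= n n0.
  by rewrite expr0n eqn0Ngt n0 mulr0.
have rp : 0 < r by rewrite lt_def rn0.
pose s := Num.sqrt r.
have sp : 0 < s by rewrite sqrtr_gt0.
have s1 : s < 1 by rewrite -sqrtr1 ltr_sqrt.
have rs : r = s * s by rewrite -expr2 sqr_sqrtr.
have del : 0 < s^-1 - 1 by rewrite subr_gt0 invf_gt1.
have bern n : n%:R * s ^+ n <= (s^-1 - 1)^-1.
  rewrite -ler_pdivlMr ?exprn_gt0 // -exprVn mulrC -ler_pdivrMr ?invr_gt0 //.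
  rewrite invrK.
  elim: n => [|n IH]; first by rewrite mul0r expr0.
  rewrite exprS -natr1 mulrDl mul1r.
  have h1 : 1 <= s^-1 ^+ n by apply: exprn_ege1; rewrite ltW // invf_gt1.
  nra.
apply/norm_cvg0P.
have H : `|C| * (s^-1 - 1)^-1 * s ^+ n @[n --> \oo] --> (0 : R).
  by apply: cvg_geometric; rewrite ger0_norm // ltW.
apply: (squeeze_cvgr _ (cvg_cst 0) H).
apply: nearW => n; rewrite normr_ge0 /= !normrM normr_nat normrX (gtr0_norm rp).
rewrite -!mulrA ler_wpM2l // rs exprMn mulrA ler_wpM2r ?exprn_ge0 ?(ltW sp) //.
Qed.

(** * The generating polynomial of the weights of a level *)

Section LevelPolynomial.
Local Open Scope ring_scope.
Variables (K : comNzRingType) (c : nat) (bet : 'I_c -> K).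

Definition level_poly : {poly K} := \prod_(i < c) (1 + bet i *: 'X).

Lemma size_level_poly : (size level_poly <= c.+1)%N.
Proof.
apply: leq_trans (size_poly_prod_leq _ _) _.
have h : (\sum_(i < c) size (1 + bet i *: 'X)%R <= \sum_(i < c) 2)%N.
  apply: leq_sum => i _; apply: leq_trans (size_polyD _ _) _.
  by rewrite geq_max size_poly1 /= (leq_trans (size_scale_leq _ _)) ?size_polyX.
have e : #|(fun _ : 'I_c => true)| = c := card_ord c.
move: h; rewrite sum_nat_const !e => h.
by rewrite leq_subLR addnS ltnS addnn -muln2.
Qed.

(** Expanding the product chooses 1 or [bet i *: 'X] at each coordinate, that is, a configuration
    [n] whose number of ones is the degree. This identifies [omega] with the coefficients of
    [level_poly]. *)
Lemma level_poly_coef m :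
  level_poly`_m = \sum_(n : {ffun 'I_c -> bool} | (\sum_(i < c) n i)%N == m)
     \prod_(i < c) bet i ^+ n i.
Proof.
rewrite /level_poly.
under eq_bigr => i _.
  have -> : 1 + bet i *: 'X = \sum_(b : bool) (bet i *: 'X) ^+ b.
    by rewrite big_bool /= expr0 expr1 addrC.
  over.
rewrite bigA_distr_bigA coef_sum [RHS]big_mkcond; apply: eq_bigr => n _.
have -> : \prod_(i < c) (bet i *: 'X) ^+ n i
    = (\prod_(i < c) bet i ^+ n i) *: 'X^(\sum_(i < c) n i) :> {poly K}.
  rewrite -prodrXr -scaler_prod; apply: eq_bigr => i _.
  by rewrite exprZn.
by rewrite coefZ coefXn eq_sym; case: eqP => _; rewrite ?mulr1 ?mulr0.
Qed.

Lemma level_poly_deriv :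
  level_poly^`() = \sum_(i < c) bet i *: \prod_(j < c | j != i) (1 + bet j *: 'X).
Proof.
rewrite /level_poly.
(* The induction needs a duplicate-free list: with repetitions the condition [j != i] would drop
   every copy of [i]. *)
have gen (r : seq 'I_c) : uniq r -> (\prod_(i <- r) (1 + bet i *: 'X))^`()
    = \sum_(i <- r) bet i *: \prod_(j <- r | j != i) (1 + bet j *: 'X).
  elim: r => [|i r IH] /=; first by rewrite !big_nil derivC.
  move=> /andP[ir ur]; rewrite !big_cons derivM IH // eqxx.
  rewrite derivD derivZ derivX derivC add0r alg_polyC mul_polyC.
  congr (_ + _).
    congr (_ *: _); rewrite big_seq [RHS]big_seq_cond; apply: eq_bigl => j.
    by case: eqP => [->|]; rewrite ?(negbTE ir) ?andbT.
  rewrite mulr_sumr; rewrite big_seq [RHS]big_seq; apply: eq_bigr => j jr.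
  rewrite big_cons; have -> : i != j by apply: contra ir => /eqP ->.
  by rewrite scalerAr.
by rewrite gen ?index_enum_uniq.
Qed.

Variables A B C D : K.

(** The shape of the level matrices over any ring: it serves for the real rates of one level and for
    the complex generating functions obtained by summation. *)
Definition tridiag (m m' : nat) : K :=
  if m' == m.+1 then A * (c - m)%:R
  else if m'.+1 == m then D * m%:R
  else if m' == m then B * (c - m)%:R + C * m%:R
  else 0.

(* As a generating function in m', the left-hand side is [level_poly] times the sum
   that the second hypothesis makes vanish. *)
Lemma level_poly_tridiag (m' : 'I_c.+1) :
  (forall i, A + C * bet i = bet i * (D * bet i + B)) ->
  \sum_(i < c) (D * bet i + B) = 0 ->
  \sum_(m < c.+1) level_poly`_m * tridiag m m' = 0.
Proof.
move=> hA hs.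
pose P := level_poly.
have XP' k : ('X * P^`())`_k = P`_k *+ k.
  by rewrite coefXM coef_deriv; case: k => [|k] /=; rewrite ?mulr0n.
(* The Euler operator multiplies the coefficient of index [m] by [m], and [Q] multiplies it by
   [c - m]: these are the two weights in [tridiag]. *)
pose Q := P *+ c - 'X * P^`().
have Qk k : (k <= c)%N -> Q`_k = P`_k *+ (c - k).
  by move=> kc; rewrite /Q coefB coefMn XP' mulrnBr.
have Pi i : P = (1 + bet i *: 'X) * \prod_(j < c | j != i) (1 + bet j *: 'X).
  by rewrite /P /level_poly (bigD1 i).
have QE : Q = \sum_(i < c) \prod_(j < c | j != i) (1 + bet j *: 'X).
  rewrite /Q -[c in P *+ c]card_ord -sumr_const level_poly_deriv mulr_sumr -sumrB.
  apply: eq_bigr => i _; rewrite [in LHS](Pi i) mulrDl mul1r -scalerAl -scalerAr.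
  by rewrite addrK.
(* In the i-th term, [hA] turns [(A + C * bet i) * 'X + (D * bet i + B)] into
   [(D * bet i + B) * (1 + bet i *: 'X)]; the last factor completes the partial product to [P]. *)
have id0 : A *: ('X * Q) + D *: P^`() + B *: Q + C *: ('X * P^`()) = 0.
  have <- : (\sum_(i < c) (D * bet i + B)) *: P = 0 by rewrite hs scale0r.
  rewrite level_poly_deriv QE !mulr_sumr !scaler_sumr scaler_suml -!big_split /=.
  apply: eq_bigr => i _; rewrite [in RHS](Pi i).
  set q := \prod_(j < c | _) _.
  rewrite -!mul_polyC !rmorphD !rmorphM /= .
  have h := congr1 polyC (hA i); rewrite !rmorphM !rmorphD !rmorphM /= in h.
  transitivity ((A%:P + C%:P * (bet i)%:P) * 'X * q + (D%:P * (bet i)%:P + B%:P) * q).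
    by ring.
  by rewrite h; ring.
have sP : (size P <= c.+1)%N := size_level_poly.
rewrite -/level_poly -/P; move: P Q XP' Qk id0 sP {Pi QE} => P Q XP' Qk id0 sP.
have := congr1 (fun p : {poly K} => p`_m') id0.
rewrite coef0 !coefD !coefZ coefXM coef_deriv XP' (Qk m' (ltn_ord m')) => h0.
rewrite -[RHS]h0.
have -> : \sum_(m < c.+1) P`_m * tridiag m m' =
    \sum_(m < c.+1) (if m.+1 == m' then P`_m * (A * (c - m)%:R) else 0)
    + \sum_(m < c.+1) (if m == m'.+1 :> nat then P`_m * (D * m%:R) else 0)
    + \sum_(m < c.+1) (if m == m' :> nat then
         P`_m * (B * (c - m)%:R + C * m%:R) else 0).
  rewrite -!big_split /=; apply: eq_bigr => m _; rewrite /tridiag.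
  rewrite eq_sym [m'.+1 == m]eq_sym [m' == m :> nat]eq_sym.
  case: (eqVneq m.+1 (m' : nat)) => [e|_].
    rewrite -e; have -> : (m == m.+2 :> nat) = false by lia.
    by have -> : (m == m.+1 :> nat) = false by [lia]; rewrite !addr0.
  case: (eqVneq (m : nat) m'.+1) => [e|_].
    by have -> : (m == m' :> nat) = false by [lia]; rewrite addr0 add0r.
  by case: ifP; rewrite !add0r ?mulr0.
rewrite -!big_mkcond /=.
rewrite (@big_ord1_eq _ _ _ (fun m => P`_m * (D * m%:R))).
rewrite (@big_ord1_eq _ _ _ (fun m => P`_m * (B * (c - m)%:R + C * m%:R))) ltn_ord.
have -> : \sum_(m < c.+1 | m.+1 == m') P`_m * (A * (c - m)%:R)
    = A * (if m' == 0 :> nat then 0 else Q`_m'.-1).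
  case: (m' : nat) (ltn_ord m') => [|k] kc.
    by rewrite eqxx mulr0 big_pred0.
  under eq_bigl => m do rewrite eqSS.
  rewrite (@big_ord1_eq _ _ _ (fun m => P`_m * (A * (c - m)%:R))).
  rewrite ltnW //= Qk; last by lia.
  by rewrite mulrCA mulr_natr.
(* For [m' = c] there is no level above, and the coefficient of index [c.+1] vanishes by the size
   bound [sP]. *)
have -> : (if (m'.+1 < c.+1)%N then P`_m'.+1 * (D * m'.+1%:R) else 0)
   = D * (P`_m'.+1 *+ m'.+1).
  case: ifP => h; first by rewrite mulrCA mulr_natr.
  rewrite [P`_m'.+1]nth_default ?mul0rn ?mulr0 //.
  by apply: leq_trans sP _; rewrite leqNgt h.
by rewrite -!addrA; congr (_ + (_ + _)); rewrite mulrDr; congr (_ + _);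
  rewrite mulrCA mulr_natr.
Qed.

End LevelPolynomial.

(** * Approximate solutions of a planar linear differential equation *)

(** Put S = P + i Q and mu = al + i nu. The function [g] is the real part of S exp(- mu s), so its
    derivative contains only the defect S' - mu S. Its cosine and sine parts give the factor 2, and
    the real mean value theorem applies to [g]. *)
Lemma twisted_mean_value (R : realType) (P Q P' Q' : R -> R) (al nu e t : R) :
  0 < t ->
  (forall s : R, 0 < s -> is_derive s 1 P (P' s)) ->
  (forall s : R, 0 < s -> is_derive s 1 Q (Q' s)) ->
  P s @[s --> 0^'+] --> P 0 -> Q s @[s --> 0^'+] --> Q 0 ->
  (forall s : R, 0 < s -> `|P' s - (al * P s - nu * Q s)| <= e) ->
  (forall s : R, 0 < s -> `|Q' s - (al * Q s + nu * P s)| <= e) ->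
  `|expR (- al * t) * (P t * cos (nu * t) + Q t * sin (nu * t)) - P 0|
    <= 2 * e * t * expR (`|al| * t).
Proof.
move=> t0 dP dQ P0 Q0 eP eQ.
pose g (s : R) := expR (- al * s) * (P s * cos (nu * s) + Q s * sin (nu * s)).
pose g' (s : R) := expR (- al * s) * ((P' s - (al * P s - nu * Q s)) * cos (nu * s)
     + (Q' s - (al * Q s + nu * P s)) * sin (nu * s)).
have dlin (k s : R) : is_derive s 1 (fun x => k * x) k.
  have -> : (fun x => k * x) = k \*: id by [].
  by apply: is_derive_eq; rewrite scaler1.
have dexp (s : R) : is_derive s 1 (fun x => expR (- al * x)) (- al * expR (- al * s)).
  have := @is_derive1_comp R expR (fun x => - al * x) s _ _ (is_derive_expR _) (dlin _ _).
  by move=> h; apply: is_derive_eq; rewrite mulrC.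
have dcos (s : R) : is_derive s 1 (fun x => cos (nu * x)) (- sin (nu * s) * nu).
  exact: (@is_derive1_comp R _ (fun x => nu * x) s _ _ (is_derive_cos _) (dlin _ _)).
have dsin (s : R) : is_derive s 1 (fun x => sin (nu * x)) (cos (nu * s) * nu).
  exact: (@is_derive1_comp R _ (fun x => nu * x) s _ _ (is_derive_sin _) (dlin _ _)).
have dg (s : R) : 0 < s -> is_derive s 1 g (g' s).
  move=> s0; have dPs := dP s s0; have dQs := dQ s s0.
  have -> : g = (fun x => expR (- al * x)) * (P * (fun x => cos (nu * x))
     + Q * (fun x => sin (nu * x))) by [].
  by apply: is_derive_eq; rewrite /g' /GRing.scale /= !fctE; ring.
(* At 0 only right continuity of [P] and [Q] is given, so the left end of the interval is treated
   apart. *)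
have cg : {within `[0, t], continuous g}.
  have cd (f : R -> R) (f' s : R) : is_derive s 1 f f' -> {for s, continuous f}.
    by move=> [/derivable1_diffP/differentiable_continuous].
  have g0 : g x @[x --> 0^'+] --> g 0.
    have cr (f : R -> R) (f' : R) : is_derive (0 : R) 1 f f' -> f x @[x --> 0^'+] --> f 0.
      by move=> /cd; apply: cvg_at_right_filter.
    apply: cvgM; first exact: cr (dexp 0).
    by apply: cvgD; apply: cvgM => //; [exact: cr (dcos 0)|exact: cr (dsin 0)].
  apply/continuous_within_itvP => //; split => //.
    by move=> x; rewrite in_itv /= => /andP[x0 _]; exact: cd (dg x x0).
  by apply: cvg_at_left_filter; exact: cd (dg t t0).
have dg_itv (s : R) : s \in `]0, t[%R -> is_derive s 1 g (g' s).
  by rewrite in_itv /= => /andP[s0 _]; exact: dg.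
have [s] := MVT t0 dg_itv cg.
rewrite in_itv /= => /andP[s0 st].
have -> : g 0 = P 0 by rewrite /g !mulr0 expR0 cos0 sin0 mulr0 addr0 mulr1 mul1r.
rewrite /g => ->; rewrite subr0 normrM (gtr0_norm t0) [leRHS]mulrAC ler_pM2r //.
rewrite normrM (ger0_norm (expR_ge0 _)) mulrC; apply: ler_pM => //.
- apply: le_trans (ler_normD _ _) _; rewrite !normrM mulr_natl mulr2n.
  have c1 : `|cos (nu * s)| <= 1 by rewrite ler_norml cos_geN1 cos_le1.
  have s1 : `|sin (nu * s)| <= 1 by rewrite ler_norml sin_geN1 sin_le1.
  apply: lerD; rewrite -[leRHS]mulr1; apply: ler_pM => //; [exact: eP|exact: eQ].
- rewrite ler_expR; apply: le_trans (ler_norm _) _; rewrite normrM normrN.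
  by rewrite (gtr0_norm s0) ler_wpM2l // ltW.
Qed.

(** As the errors vanish, the twisted real and imaginary parts at [t] have the same limits as the
    parts at 0. Undoing the twist multiplies the limit by the exponential. *)
Lemma twisted_convergence (R : realType) (P Q P' Q' : nat -> R -> R) (e : nat -> R)
    (al nu t : R) (z : R[i]) :
  0 < t ->
  (forall N (s : R), 0 < s -> is_derive s 1 (P N) (P' N s)) ->
  (forall N (s : R), 0 < s -> is_derive s 1 (Q N) (Q' N s)) ->
  (forall N, P N s @[s --> 0^'+] --> P N 0) ->
  (forall N, Q N s @[s --> 0^'+] --> Q N 0) ->
  (forall N (s : R), 0 < s -> `|P' N s - (al * P N s - nu * Q N s)| <= e N) ->
  (forall N (s : R), 0 < s -> `|Q' N s - (al * Q N s + nu * P N s)| <= e N) ->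
  e @ \oo --> (0 : R) ->
  ctends (fun N => P N 0 +i* Q N 0) z ->
  ctends (fun N => P N t +i* Q N t) (z * cexp (t%:C * (al +i* nu))).
Proof.
move=> t0 dP dQ P0 Q0 eP eQ e0 hz.
have ebound (f g : nat -> R) (l : R) : f @ \oo --> l ->
    (forall N, `|g N - f N| <= 2 * e N * t * expR (`|al| * t)) -> g @ \oo --> l.
  move=> fl fg.
  have gf : (fun N => g N - f N) @ \oo --> (0 : R).
    apply/norm_cvg0P.
    have H : (fun N => 2 * e N * t * expR (`|al| * t)) @ \oo --> (0 : R).
      have -> : 0 = 2 * 0 * t * expR (`|al| * t) by rewrite mulr0 !mul0r.
      by do 2 apply: cvgMr_tmp; exact: cvgMl_tmp.
    by apply: (squeeze_cvgr _ (cvg_cst 0) H); apply: nearW => N; rewrite normr_ge0 /=.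
  have -> : g = (fun N => g N - f N + f N) by apply/funext => N; rewrite subrK.
  by rewrite -[l]add0r; exact: cvgD gf fl.
have hX : (fun N => expR (- al * t) * (P N t * cos (nu * t) + Q N t * sin (nu * t)))
    @ \oo --> complex.Re z.
  apply: ebound (ctends_Re hz) _ => N /=.
  exact: twisted_mean_value (dP N) (dQ N) (P0 N) (Q0 N) (eP N) (eQ N).
have hY : (fun N => expR (- al * t) * (Q N t * cos (nu * t) - P N t * sin (nu * t)))
    @ \oo --> complex.Im z.
  (* The pair (Q, - P), i.e. - i (P + i Q), satisfies the same approximate equation. *)
  apply: ebound (ctends_Im hz) _ => N /=; rewrite -mulNr.
  apply: (@twisted_mean_value _ (Q N) (fun s => - P N s) (Q' N) (fun s => - P' N s)).
  - exact: t0.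
  - by move=> s s0; have := dP N s s0; exact: is_deriveN.
  - exact: (Q0 N).
  - by apply: cvgN; exact: P0.
  - by move=> s s0; rewrite mulrN opprK; exact: eQ.
  - move=> s s0; rewrite -normrN.
    have <- : P' N s - (al * P N s - nu * Q N s)
        = - (- P' N s - (al * - P N s + nu * Q N s)) by ring.
    exact: eP.
have EE : expR (- al * t) * expR (t * al) = 1.
  by rewrite -expRD mulNr mulrC addNr expR0.
have cs := cos2Dsin2 (nu * t).
have -> : z * cexp (t%:C * (al +i* nu)) = expR (t * al) *
    (complex.Re z * cos (nu * t) - complex.Im z * sin (nu * t)) +i*
    (expR (t * al) * (complex.Re z * sin (nu * t) + complex.Im z * cos (nu * t))).
  case: z {hz hX hY} => zr zi; rewrite /cexp /= !mul0r subr0 addr0 [nu * t]mulrC.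
  by apply/eqP; rewrite eq_complex /=; apply/andP; split; apply/eqP; ring.
apply: ctends_ReIm => /=.
  (* The inverse rotation recovers [P] from the two twisted combinations, by [cs] and [EE]; [Q] is
     recovered likewise below. *)
  have -> : (fun N => P N t) = (fun N => expR (t * al) *
    ((expR (- al * t) * (P N t * cos (nu * t) + Q N t * sin (nu * t))) * cos (nu * t)
    - (expR (- al * t) * (Q N t * cos (nu * t) - P N t * sin (nu * t))) * sin (nu * t))).
    apply/funext => N.
    transitivity ((expR (- al * t) * expR (t * al)) *
      (P N t * (cos (nu * t) ^+ 2 + sin (nu * t) ^+ 2))); last by ring.
    by rewrite EE cs mulr1 mul1r.
  apply: cvgM; first exact: cvg_cst.
  by apply: cvgB; apply: cvgM => //; exact: cvg_cst.
have -> : (fun N => Q N t) = (fun N => expR (t * al) *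
    ((expR (- al * t) * (P N t * cos (nu * t) + Q N t * sin (nu * t))) * sin (nu * t)
    + (expR (- al * t) * (Q N t * cos (nu * t) - P N t * sin (nu * t))) * cos (nu * t))).
  apply/funext => N.
  transitivity ((expR (- al * t) * expR (t * al)) *
      (Q N t * (cos (nu * t) ^+ 2 + sin (nu * t) ^+ 2))); last by ring.
  by rewrite EE cs mulr1 mul1r.
apply: cvgM; first exact: cvg_cst.
by apply: cvgD; apply: cvgM => //; exact: cvg_cst.
Qed.

(** * Finite sums: derivatives, one-sided limits, rearrangement *)

Lemma is_derive_wsum (R : realType) (I : Type) (r : seq I) (w : I -> R)
    (f : I -> R -> R) (df : I -> R) (s : R) :
  (forall i, is_derive s 1 (f i) (df i)) ->
  is_derive s 1 (fun x => \sum_(i <- r) w i * f i x) (\sum_(i <- r) w i * df i).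
Proof.
move=> h; elim: r => [|i r IH].
  rewrite big_nil.
  have -> : (fun x => \sum_(i <- [::]) w i * f i x) = cst 0.
    by apply/funext => x; rewrite big_nil.
  exact: is_derive_cst.
rewrite big_cons.
have -> : (fun x => \sum_(j <- i :: r) w j * f j x)
    = (w i \*: f i) + (fun x => \sum_(j <- r) w j * f j x).
  by apply/funext => x; rewrite big_cons.
by apply: is_deriveD; exact: is_deriveZ.
Qed.

Lemma cvg_at_right_wsum (R : realType) (I : Type) (r : seq I) (w : I -> R)
    (f : I -> R -> R) (x : R) :
  (forall i, f i s @[s --> x^'+] --> f i x) ->
  \sum_(i <- r) w i * f i s @[s --> x^'+] --> \sum_(i <- r) w i * f i x.
Proof.
move=> h; elim: r => [|i r IH].
  have -> : (fun s => \sum_(i <- [::]) w i * f i s) = cst 0.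
    by apply/funext => s; rewrite big_nil.
  by rewrite big_nil; exact: cvg_cst.
have -> : (fun s => \sum_(j <- i :: r) w j * f j s)
    = (fun s => w i * f i s + \sum_(j <- r) w j * f j s).
  by apply/funext => s; rewrite big_cons.
by rewrite big_cons; apply: cvgD => //; exact: cvgMl_tmp.
Qed.

(** Pairs made of a starting level and a downward jump [k] are regrouped by the level reached, so
    that each level collects its whole coefficient. *)
Lemma sum_triangle (V : nmodType) (G : nat -> nat -> V) (N : nat) :
  \sum_(0 <= l < N) \sum_(1 <= k < l.+1) G k (l - k)%N
  = \sum_(0 <= l < N) \sum_(1 <= k < N - l) G k l.
Proof.
elim: N => [|N IH]; first by rewrite !big_geq.
rewrite big_nat_recr //= IH [RHS]big_nat_recr //= subSnn [X in _ = _ + X]big_geq // addr0.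
(* The new row [l = N] adds exactly one entry to each column [l < N]. *)
have -> : \sum_(1 <= k < N.+1) G k (N - k)%N = \sum_(0 <= l < N) G (N - l)%N l.
  rewrite big_add1 /= big_nat_rev /= big_nat [RHS]big_nat; apply: eq_bigr => l hl.
  by congr (G _ _); lia.
rewrite -big_split /= big_nat [RHS]big_nat; apply: eq_bigr => l hl.
by rewrite subSn ?big_nat_recr //=; lia.
Qed.

Lemma complexRE (R : realType) (r : R) (z : R[i]) :
  (complex.Re (z * r%:C) = complex.Re z * r)
  * (complex.Im (z * r%:C) = complex.Im z * r).
Proof. by case: z => a b /=; rewrite !mulr0 subr0 add0r. Qed.

(** * The differential equation of the partial sums for one root *)

Section LevelEquation.
Variables (R : realType) (K p : nat) (L : int -> 'M[R]_p) (om : 'I_p -> R[i]).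
Variables (z : R[i]) (lam : nat -> R) (bnd : R) (Fs : nat -> 'I_p -> R -> R).

Definition level_row (k : int) (m' : 'I_p) : R[i] :=
  \sum_(m < p) om m * (L k m m')%:C.

(** Counting downwards from the largest jump [K] makes the balance equation a power series in
    [z]. *)
Definition balance_sum (m' : 'I_p) (n : nat) : R[i] :=
  z ^+ n * level_row (K%:Z - n%:Z) m'.

(** A suppressed upward jump by [i] keeps its level, so it enters with weight 1 where the balance
    equation has [z ^- i]; the difference of the weights appears here. *)
Definition decay_rate : R[i] :=
  \sum_(1 <= i < K.+1) (1 - (z ^+ i)^-1) * (lam i)%:C.

Definition level_rhs (n0 : nat) (m : 'I_p) (t : R) : R :=
  \sum_(m' < p) (\sum_(0 <= i < K.+1) L i%:Z) m m' * Fs n0 m' t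
  + \sum_(1 <= k < n0.+1) \sum_(m' < p) L (- k%:Z) m m' * Fs (n0 - k)%N m' t.

(** The function [f] is a parameter because the same sum is formed with [Fs] and with its derivative
    [level_rhs]. *)
Definition level_term (f : nat -> 'I_p -> R -> R) (s : R) (n0 : nat) : R[i] :=
  \sum_(m < p) z ^+ n0 * om m * (f n0 m s)%:C.

Hypothesis z1 : normc z < 1.
Hypothesis z0 : z != 0.
Hypothesis L_bounded : forall (n : nat) m m', `|L (K%:Z - n%:Z) m m'| <= bnd.
Hypothesis balance : forall m', ctends (series (balance_sum m')) 0.
Hypothesis L_up : forall i, (1 <= i <= K)%N -> L i%:Z = (lam i)%:M.

Lemma level_row_up i m' : (1 <= i <= K)%N ->
  level_row i%:Z m' = (lam i)%:C * om m'.
Proof.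
move=> hi; rewrite /level_row L_up // (bigD1 m') //= mxE eqxx mulr1n big1 ?addr0.
  by rewrite mulrC.
by move=> m /negbTE mm'; rewrite mxE mm' mulr0n mulr0.
Qed.

Lemma balance_bound m' n : normc (series (balance_sum m') n)
  <= (\sum_(m < p) normc (om m)) * bnd / (1 - normc z) * normc z ^+ n.
Proof.
apply: series_tail_bound; rewrite ?normc_ge0 // => k.
rewrite normcM normcX mulrC ler_wpM2r ?exprn_ge0 ?normc_ge0 //.
apply: le_trans (normc_sum _ _ _) _; rewrite mulr_suml; apply: ler_sum => m _.
by rewrite normcM normc_real ler_wpM2l ?normc_ge0.
Qed.

(** Dividing the partial balance sum by [z ^+ K] gives the same row except that upward jumps carry
    [z ^- i] instead of 1. By [level_row_up] the discrepancy is [decay_rate * om m']. *)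
Lemma truncated_row M m' : (0 < M)%N ->
  \sum_(0 <= i < K.+1) level_row i%:Z m'
    + \sum_(1 <= k < M) z ^+ k * level_row (- k%:Z) m'
  = decay_rate * om m' + (z ^+ K)^-1 * series (balance_sum m') (K + M)%N.
Proof.
move=> M0; rewrite /series /= (@big_cat_nat _ _ _ K 0 (K + M)) ?leq_addr //= mulrDr.
(* The indices [n = K - i] below [K] are the upward jumps; those from [K] on, [n = K + k], are the
   others. *)
have -> : (z ^+ K)^-1 * \sum_(0 <= n < K) balance_sum m' n
    = \sum_(1 <= i < K.+1) (z ^+ i)^-1 * level_row i%:Z m'.
  rewrite mulr_sumr big_add1 /= big_nat_rev /= big_nat [RHS]big_nat.
  apply: eq_bigr => i hi; rewrite /balance_sum mulrA add0n.
  have -> : K%:Z - (K - i.+1)%N%:Z = i.+1%:Z by lia.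
  congr (_ * _); have -> : z ^+ K = z ^+ (K - i.+1) * z ^+ i.+1.
    by rewrite -exprD subnK //; lia.
  by rewrite invfM mulrAC mulVf ?mul1r // expf_neq0.
have -> : (z ^+ K)^-1 * \sum_(K <= n < K + M) balance_sum m' n
    = \sum_(0 <= k < M) z ^+ k * level_row (- k%:Z) m'.
  rewrite -[X in \sum_(X <= _ < _) _]add0n big_addn addKn mulr_sumr; apply: eq_bigr => k _.
  rewrite /balance_sum mulrA addnC exprD mulrA mulVf ?expf_neq0 // mul1r.
  by congr (_ * level_row _ _); lia.
have -> : \sum_(0 <= k < M) z ^+ k * level_row (- k%:Z) m'
    = level_row 0 m' + \sum_(1 <= k < M) z ^+ k * level_row (- k%:Z) m'.
  by rewrite big_ltn // expr0 mul1r oppr0.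
have -> : \sum_(0 <= i < K.+1) level_row i%:Z m'
    = level_row 0 m' + (decay_rate * om m'
        + \sum_(1 <= i < K.+1) (z ^+ i)^-1 * level_row i%:Z m').
  rewrite big_ltn //; congr (_ + _).
  rewrite /decay_rate mulr_suml -big_split /= big_nat [RHS]big_nat.
  by apply: eq_bigr => i hi; rewrite level_row_up //; ring.
by ring.
Qed.

(** After regrouping by the level reached, the coefficients of [Fs l] form [z ^+ l] times a row
    truncated at [N - l], and [truncated_row] leaves only partial balance sums. *)
Lemma level_defect N s :
  \sum_(0 <= l < N) level_term level_rhs s l
    - decay_rate * \sum_(0 <= l < N) level_term Fs s l
  = (z ^+ K)^-1 * \sum_(0 <= l < N) z ^+ l *
      \sum_(m' < p) series (balance_sum m') (K + (N - l))%N * (Fs l m' s)%:C.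
Proof.
(* The exponent is written [k + (l - k)] to match the shape required by [sum_triangle]. *)
have rhsE l : level_term level_rhs s l = z ^+ l *
      (\sum_(m' < p) (\sum_(0 <= i < K.+1) level_row i%:Z m') * (Fs l m' s)%:C)
    + \sum_(1 <= k < l.+1) z ^+ (k + (l - k)) *
      \sum_(m' < p) level_row (- k%:Z) m' * (Fs (l - k)%N m' s)%:C.
  have rowE (k : int) (n : nat) : \sum_(m' < p) level_row k m' * (Fs n m' s)%:C
      = \sum_(m < p) om m * (\sum_(m' < p) L k m m' * Fs n m' s)%:C.
    under eq_bigr do rewrite mulr_suml.
    rewrite exchange_big /=; apply: eq_bigr => m _.
    rewrite rmorph_sum mulr_sumr /=; apply: eq_bigr => m' _.
    by rewrite rmorphM mulrA.
  have -> : \sum_(m' < p) (\sum_(0 <= i < K.+1) level_row i%:Z m') * (Fs l m' s)%:C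
      = \sum_(m < p) om m *
          (\sum_(m' < p) (\sum_(0 <= i < K.+1) L i%:Z) m m' * Fs l m' s)%:C.
    under eq_bigr do rewrite mulr_suml.
    rewrite exchange_big /=; under eq_bigr do rewrite rowE.
    rewrite exchange_big /=; apply: eq_bigr => m _.
    rewrite -mulr_sumr -rmorph_sum; congr (_ * _%:C).
    rewrite exchange_big /=; apply: eq_bigr => m' _.
    by rewrite summxE mulr_suml.
  under [X in _ = _ + X]eq_big_nat => k hk.
    rewrite rowE; have -> : (k + (l - k) = l)%N by lia.
    over.
  rewrite -mulr_sumr exchange_big /= -mulrDr -big_split /= mulr_sumr.
  apply: eq_bigr => m _; rewrite /level_rhs -mulrA; congr (_ * _).
  by rewrite -mulr_sumr -mulrDr rmorphD; congr (_ * (_ + _)); rewrite rmorph_sum.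
under eq_bigr do rewrite rhsE.
rewrite big_split /= (sum_triangle (fun k l => z ^+ (k + l) *
      \sum_(m' < p) level_row (- k%:Z) m' * (Fs l m' s)%:C)).
rewrite !mulr_sumr -big_split -sumrB /= big_nat [RHS]big_nat.
apply: eq_bigr => l hl.
have -> : \sum_(1 <= k < N - l) z ^+ (k + l) *
      \sum_(m' < p) level_row (- k%:Z) m' * (Fs l m' s)%:C
    = z ^+ l * \sum_(m' < p)
        (\sum_(1 <= k < N - l) z ^+ k * level_row (- k%:Z) m') * (Fs l m' s)%:C.
  under [X in _ = _ * X]eq_bigr do rewrite mulr_suml.
  rewrite exchange_big /= mulr_sumr; apply: eq_bigr => k _.
  rewrite exprD [z ^+ k * _]mulrC -mulrA; congr (_ * _); rewrite mulr_sumr.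
  by apply: eq_bigr => m' _; rewrite mulrA.
have -> : decay_rate * level_term Fs s l
    = z ^+ l * \sum_(m' < p) decay_rate * om m' * (Fs l m' s)%:C.
  rewrite /level_term !mulr_sumr; apply: eq_bigr => m' _; ring.
rewrite -mulrDr -mulrBr [RHS]mulrCA; congr (_ * _).
rewrite -big_split -sumrB /= mulr_sumr; apply: eq_bigr => m' _.
rewrite -mulrDl -mulrBl mulrA truncated_row; last by lia.
by rewrite addrAC subrr add0r.
Qed.

Hypothesis F_init : forall n0 m, Fs n0 m 0 = 1.
Hypothesis F_cont : forall n0 m, Fs n0 m x @[x --> 0^'+] --> Fs n0 m 0.
Hypothesis F_range : forall n0 m t, 0 <= t -> 0 <= Fs n0 m t <= 1.
Hypothesis F_deriv : forall n0 m (t : R), 0 < t ->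
  is_derive t 1 (Fs n0 m) (level_rhs n0 m t).

(** The factor [z ^+ l] and the balance tail from [K + (N - l)] together have order
    [normc z ^+ (K + N)] for every [l], so [N] levels give a linear factor. The bound 0 <= [Fs] <= 1
    makes it uniform in [s]. *)
Lemma level_defect_bound N (s : R) : 0 < s ->
  normc (\sum_(0 <= l < N) level_term level_rhs s l
    - decay_rate * \sum_(0 <= l < N) level_term Fs s l)
  <= p%:R * ((\sum_(m < p) normc (om m)) * bnd / (1 - normc z)) * N%:R * normc z ^+ N.
Proof.
move=> s0; rewrite level_defect normcM normcV normcX.
set C := (\sum_(m < p) _) * bnd / _.
have nz : normc z != 0 by apply: contraNneq z0 => /eq0_normc ->.
rewrite mulrC ler_pdivrMr ?exprn_gt0 ?lt_def ?nz ?normc_ge0 //.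
apply: le_trans (normc_sum _ _ _) _.
have -> : p%:R * C * N%:R * normc z ^+ N * normc z ^+ K
    = \sum_(0 <= l < N) p%:R * C * normc z ^+ (K + N).
  by rewrite sumr_const_nat subn0 -mulr_natr exprD; ring.
apply: ler_sum_nat => l hl; rewrite normcM normcX.
have -> : p%:R * C * normc z ^+ (K + N)
    = normc z ^+ l * \sum_(m' < p) C * normc z ^+ (K + (N - l)).
  rewrite sumr_const card_ord -mulr_natr.
  have -> : (K + N = l + (K + (N - l)))%N by lia.
  by rewrite exprD; ring.
rewrite ler_wpM2l ?exprn_ge0 ?normc_ge0 //.
apply: le_trans (normc_sum _ _ _) _; apply: ler_sum => m' _.
rewrite normcM normc_real -[leRHS]mulr1; apply: ler_pM; rewrite ?normc_ge0 //.
  exact: balance_bound.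
by have /andP[h1 h2] := F_range l m' (ltW s0); rewrite ger0_norm.
Qed.

Lemma level_series_init :
  ctends (series (level_term Fs 0)) ((\sum_(m < p) om m) / (1 - z)).
Proof.
have z1' : 1 - z != 0.
  apply: contraTneq z1 => /eqP; rewrite subr_eq0 => /eqP <-.
  by rewrite normc1 ltxx.
have zN : ctends (fun N => z ^+ N) 0.
  have h : `|normc z| < 1 by rewrite ger0_norm ?normc_ge0.
  apply: cvg_trans (cvg_geometric 1 h); apply: near_eq_cvg; apply: nearW => N /=.
  by rewrite subr0 normcX mul1r.
have := ctendsMl ((\sum_(m < p) om m) / (1 - z))
  (ctendsD (ctends_cst 1) (ctendsMl (-1) zN)).
rewrite mulr0 addr0 mulr1; apply: (@eq_ctends _ _ _ _ 0%N) => N _.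
elim: N => [|N IH].
  by rewrite /series /= big_geq // expr0 mulr1 subrr mulr0.
rewrite /series /= big_nat_recr //= -[X in _ = X + _]IH.
have -> : level_term Fs 0 N = z ^+ N * \sum_(m < p) om m.
  by rewrite mulr_sumr; apply: eq_bigr => m _; rewrite F_init mulr1.
by rewrite exprS; field.
Qed.

Lemma level_series (t : R) : 0 <= t ->
  ctends (series (level_term Fs t))
    ((\sum_(m < p) om m) / (1 - z) * cexp (t%:C * decay_rate)).
Proof.
rewrite le_eqVlt => /orP[/eqP <-|t0].
  (* The time 0 is separate: the derivative is known only at positive times. *)
  by rewrite mul0r /cexp /= expR0 cos0 sin0 mulr1 mulr1; exact: level_series_init.
pose P (f : nat -> 'I_p -> R -> R) N s :=
  complex.Re (\sum_(0 <= l < N) level_term f s l).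
pose Q (f : nat -> 'I_p -> R -> R) N s :=
  complex.Im (\sum_(0 <= l < N) level_term f s l).
(* The factor [1] gives the outer sum the weighted form of [is_derive_wsum]. *)
have PE f N s : P f N s = \sum_(0 <= l < N) 1 *
    \sum_(m < p) complex.Re (z ^+ l * om m) * f l m s.
  rewrite /P Re_sum; apply: eq_bigr => l _; rewrite mul1r Re_sum.
  by apply: eq_bigr => m _; rewrite complexRE.
have QE f N s : Q f N s = \sum_(0 <= l < N) 1 *
    \sum_(m < p) complex.Im (z ^+ l * om m) * f l m s.
  rewrite /Q Im_sum; apply: eq_bigr => l _; rewrite mul1r Im_sum.
  by apply: eq_bigr => m _; rewrite complexRE.
have z1' : 0 <= normc z < 1 by rewrite normc_ge0.
have eta_c (w : R[i]) : complex.Re w +i* complex.Im w = w by case: w.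
pose e (N : nat) : R := p%:R * ((\sum_(m < p) normc (om m)) * bnd / (1 - normc z))
  * N%:R * normc z ^+ N.
have defect N (s : R) : 0 < s ->
    `|P level_rhs N s - (complex.Re decay_rate * P Fs N s
        - complex.Im decay_rate * Q Fs N s)| <= e N
    /\ `|Q level_rhs N s - (complex.Re decay_rate * Q Fs N s
        + complex.Im decay_rate * P Fs N s)| <= e N.
  move=> s0; have := level_defect_bound N s0; rewrite -/(e N) /P /Q.
  move: (\sum_(0 <= l < N) _) decay_rate (\sum_(0 <= l < N) _) => [a b] [c d] [f g] h.
  split; apply: le_trans h.
    exact: le_trans (Re_le_normc _).
  exact: le_trans (Im_le_normc _).
have := @twisted_convergence R (P Fs) (Q Fs) (P level_rhs) (Q level_rhs) e
  (complex.Re decay_rate) (complex.Im decay_rate) t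
  ((\sum_(m < p) om m) / (1 - z)) t0.
rewrite eta_c.
have ser s : (fun N => P Fs N s +i* Q Fs N s) = series (level_term Fs s).
  by apply/funext => N; rewrite /P /Q eta_c.
rewrite !ser; apply.
- move=> N s s0; have -> : P Fs N = fun s => P Fs N s by [].
  under eq_fun do rewrite PE; rewrite PE.
  apply: is_derive_wsum => l; apply: is_derive_wsum => m; exact: F_deriv.
- move=> N s s0; have -> : Q Fs N = fun s => Q Fs N s by [].
  under eq_fun do rewrite QE; rewrite QE.
  apply: is_derive_wsum => l; apply: is_derive_wsum => m; exact: F_deriv.
- move=> N; under eq_cvg do rewrite PE; rewrite PE.
  by apply: (cvg_at_right_wsum _ (f := fun l s => _)) => l; apply: cvg_at_right_wsum.
- move=> N; under eq_cvg do rewrite QE; rewrite QE.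
  by apply: (cvg_at_right_wsum _ (f := fun l s => _)) => l; apply: cvg_at_right_wsum.
- by move=> N s s0; have [] := defect N s s0.
- by move=> N s s0; have [] := defect N s s0.
- exact: cvg_linear_geometric.
- exact: level_series_init.
Qed.

End LevelEquation.

(** * Linear operations on complex series *)

Lemma ctends_seriesD (R : realType) (u v : nat -> R[i]) (l k : R[i]) :
  ctends (series u) l -> ctends (series v) k ->
  ctends (series (fun n => u n + v n)) (l + k).
Proof.
move=> hu hv; have -> : series (fun n => u n + v n) = (fun n => series u n + series v n).
  by apply/funext => n; rewrite /series /= big_split.
exact: ctendsD.
Qed.

Lemma ctends_seriesMr (R : realType) (u : nat -> R[i]) (l x : R[i]) :
  ctends (series u) l -> ctends (series (fun n => u n * x)) (l * x).
Proof.
move=> hu; have -> : series (fun n => u n * x) = (fun n => x * series u n).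
  by apply/funext => n; rewrite /series /= -mulr_suml mulrC.
by rewrite mulrC; exact: ctendsMl.
Qed.

Lemma ctends_series_delta (R : realType) (k : nat) (x : R[i]) :
  ctends (series (fun n => if n == k then x else 0)) x.
Proof.
apply: (@eq_ctends _ _ _ _ k.+1) (ctends_cst x) => N kN.
by rewrite /series /= -big_mkcond big_nat1_eq /= kN.
Qed.

(** * Generating functions of the level matrices *)

Section ModelBridge.
Variables (R : realType) (a b cr d : int -> R) (K c : nat).

Lemma summable_bounded (u : nat -> R) : rsummable u ->
  exists2 B : R, 0 <= B & forall n, `|u n| <= B.
Proof.
move=> /cvg_series_cvg_0/cvgP/cvg_seq_bounded [M [_ hM]].
exists (Num.max 0 (M + 1)); first by rewrite le_max lexx.
move=> n; rewrite le_max; apply/orP; right.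
by apply: hM => //; rewrite ltrDl.
Qed.

Lemma rserD (u v : nat -> R) (x y : R) : rsummable u -> rsummable v ->
  rser (fun n => u n * x + v n * y) = rser u * x + rser v * y.
Proof.
move=> hu hv; apply/cvg_lim => //.
have -> : series (fun n => u n * x + v n * y)
    = (fun n => series u n * x + series v n * y).
  by apply/funext => n; rewrite /series /= big_split /= !mulr_suml.
by apply: cvgD; apply: cvgMr_tmp.
Qed.

Lemma genz_ctends (r : int -> R) (z : R[i]) : rsummable (coef K r) ->
  normc z < 1 ->
  ctends (series (fun n => (coef K r n)%:C * z ^+ n)) (genz K r z).
Proof.
move=> /summable_bounded[B _ hB] z1; rewrite /genz.
apply: (@ctends_geometric_bound _ _ B (normc z)); first by rewrite normc_ge0.
by move=> n; rewrite normcM normcX normc_real ler_wpM2r ?exprn_ge0 ?normc_ge0.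
Qed.

Lemma genz0 (r : int -> R) : genz K r 0 = (r K%:Z)%:C.
Proof.
rewrite /genz.
suff h : ctends (series (fun n => (coef K r n)%:C * 0 ^+ n)) (r K%:Z)%:C.
  by have [_ ->] := ctends_cser h.
apply: (@eq_ctends _ _ _ _ 1%N) (ctends_cst _) => -[//|n] _.
rewrite /series /= big_nat_recl // expr0 mulr1 big1 ?addr0; last first.
  by move=> i _; rewrite expr0n mulr0.
by rewrite /coef subr0.
Qed.

Hypothesis summ : [/\ rsummable (coef K a), rsummable (coef K b),
  rsummable (coef K cr) & rsummable (coef K d)].

Let up : R := gen1 K a + gen1 K b.
Let down : R := gen1 K cr + gen1 K d.

(** At [n = K], the jump 0, the diagonal loses the total exit rate, which splits as
    [(c - m) * up + m * down]; it is thus absorbed into the two diagonal parameters. *)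
Lemma Lam_tridiag (n : nat) (m m' : 'I_c.+1) :
  Lam a b cr d K c (K%:Z - n%:Z) m m'
  = tridiag c (coef K a n) (coef K b n - (n == K)%:R * up)
      (coef K cr n - (n == K)%:R * down) (coef K d n) m m'.
Proof.
have [sa sb sc sd] := summ.
rewrite mxE /tridiag; case: ifP => // _; case: ifP => // _; case: ifP => // _.
have -> : (K%:Z - n%:Z == 0) = (n == K) by lia.
case: eqP => _; last by rewrite !mul0r !subr0.
have cvgS (u v : nat -> R) : rsummable u -> rsummable v ->
    rsummable (fun n => u n + v n) /\ rser (fun n => u n + v n) = rser u + rser v.
  move=> hu hv.
  have h : series (fun n => u n + v n) @ \oo --> rser u + rser v.
    have -> : series (fun n => u n + v n) = (fun n => series u n + series v n).
      by apply/funext => k; rewrite /series /= big_split.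
    exact: cvgD.
  by split; [apply/cvg_ex; exists (rser u + rser v)|apply/cvg_lim].
have [sab eab] := cvgS _ _ sa sb; have [scd ecd] := cvgS _ _ sc sd.
rewrite rserD // eab ecd /up /down /gen1 /= mulr1n.
move: (rser (coef K a)) (rser (coef K b)) (rser (coef K cr)) (rser (coef K d)).
by move=> ? ? ? ?; rewrite /coef; ring.
Qed.

Lemma tridiag_bound (A B C D : R) (m m' : nat) : (m <= c)%N ->
  `|tridiag c A B C D m m'| <= (`|A| + `|B| + `|C| + `|D|) * c%:R.
Proof.
move=> mc; have cm : (c - m)%:R <= c%:R :> R by rewrite ler_nat leq_subr.
have mc' : m%:R <= c%:R :> R by rewrite ler_nat.
have h (x : R) k : k%:R <= c%:R :> R -> `|x * k%:R| <= `|x| * c%:R.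
  by move=> hk; rewrite normrM normr_nat ler_wpM2l.
have n0 (x : R) : 0 <= `|x| * c%:R by rewrite mulr_ge0.
have := (h A _ cm, h B _ cm, h C _ mc', h D _ mc', n0 A, n0 B, n0 C, n0 D).
rewrite /tridiag !mulrDl => -[] [] [] [] [] [] [] hA hB hC hD ? ? ? ?.
case: ifP => _; first by lra.
case: ifP => _; first by lra.
case: ifP => _; last by rewrite normr0; lra.
by apply: le_trans (ler_normD _ _) _; lra.
Qed.

Lemma Lam_bounded : exists B, forall (n : nat) m m',
  `|Lam a b cr d K c (K%:Z - n%:Z) m m'| <= B.
Proof.
have [/summable_bounded[Ba Ba0 hA] /summable_bounded[Bb _ hB]
  /summable_bounded[Bc _ hC] /summable_bounded[Bd _ hD]] := summ.
exists ((Ba + (Bb + `|up|) + (Bc + `|down|) + Bd) * c%:R) => n m m'.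
rewrite Lam_tridiag; apply: le_trans (tridiag_bound _ _ _ _ _ _) _.
  by rewrite -ltnS.
have ind (x : R) : `|(n == K)%:R * x| <= `|x|.
  by case: eqP; rewrite ?mul1r ?mul0r ?normr0.
rewrite ler_wpM2r //; do 2 (apply: lerD => //); first apply: lerD => //.
  by apply: le_trans (ler_normB _ _) _; apply: lerD.
by apply: le_trans (ler_normB _ _) _; apply: lerD.
Qed.

Variable z : R[i].
Hypothesis z1 : normc z < 1.

(** The entries of [tridiag] are linear in its parameters, so summation turns rates into generating
    functions, and the exit rates at [n = K] into the [z ^+ K] terms. *)
Lemma Lam_ctends (m m' : 'I_c.+1) :
  ctends (series (fun n => z ^+ n * (Lam a b cr d K c (K%:Z - n%:Z) m m')%:C))
    (tridiag c (genz K a z) (genz K b z - z ^+ K * up%:C)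
       (genz K cr z - z ^+ K * down%:C) (genz K d z) m m').
Proof.
have [sa sb sc sd] := summ.
have ca := genz_ctends sa z1; have cb := genz_ctends sb z1.
have cc := genz_ctends sc z1; have cd := genz_ctends sd z1.
have -> : (fun n => z ^+ n * (Lam a b cr d K c (K%:Z - n%:Z) m m')%:C)
    = (fun n => tridiag c ((coef K a n)%:C * z ^+ n)
         ((coef K b n)%:C * z ^+ n - (if n == K then z ^+ K * up%:C else 0))
         ((coef K cr n)%:C * z ^+ n - (if n == K then z ^+ K * down%:C else 0))
         ((coef K d n)%:C * z ^+ n) m m').
  apply/funext => n; rewrite Lam_tridiag /tridiag.
  case: ifP => _; first by rewrite rmorphM /= rmorph_nat; ring.
  case: ifP => _; first by rewrite rmorphM /= rmorph_nat; ring.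
  case: ifP => _; last by rewrite mulr0.
  rewrite rmorphD !rmorphM !rmorphB !rmorphM /= !rmorph_nat.
  by case: eqP => [->|_]; rewrite /=; ring.
have shift (r : int -> R) (x : R) :
    ctends (series (fun n => (coef K r n)%:C * z ^+ n)) (genz K r z) ->
    ctends (series (fun n => (coef K r n)%:C * z ^+ n
      - (if n == K then z ^+ K * x%:C else 0))) (genz K r z - z ^+ K * x%:C).
  move=> hr; have := ctends_seriesD hr
    (ctends_seriesMr (-1) (ctends_series_delta K (z ^+ K * x%:C))).
  rewrite mulrN1; apply: (@eq_ctends _ _ _ _ 0%N) => N _; apply: eq_bigr => n _.
  by rewrite mulrN1.
rewrite /tridiag; case: ifP => _; first exact: ctends_seriesMr.
case: ifP => _; first exact: ctends_seriesMr.
case: ifP => _.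
  by apply: ctends_seriesD; apply: ctends_seriesMr; exact: shift.
apply: (@eq_ctends _ _ _ _ 0%N) (ctends_cst 0) => N _.
by rewrite /series /= big1.
Qed.

End ModelBridge.

(** * The quadratic equation, the balance equation and nonzero roots *)

(** The quadratic formula: multiplying by [4 D] completes the square, and the sign disappears
    through [xx]. *)
Lemma beta_i_root (R : realType) (a b cr d : int -> R) (K : nat) (Rf : R[i] -> R[i])
    (z : R[i]) (x : R) :
  x = 1 \/ x = -1 -> genz K d z != 0 ->
  Rf z ^+ 2 = Ffun a b cr d K z ^+ 2 + 4%:R * genz K a z * genz K d z ->
  let y := beta_i a b cr d K Rf z x in
  genz K a z + Ffun a b cr d K z * y = genz K d z * y ^+ 2.
Proof.
move=> hx D0 hR y.
have xx : x%:C ^+ 2 = 1 :> R[i].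
  by rewrite -rmorphXn /=; case: hx => ->; rewrite ?sqrrN expr1n.
have two : 2%:R != 0 :> R[i] by rewrite pnatr_eq0.
set F := Ffun _ _ _ _ _ _ in hR y *; set D := genz K d z in D0 hR y *.
have yE : 2%:R * D * y = F + x%:C * Rf z.
  by rewrite /y /beta_i -/F -/D mulrC divfK // mulf_neq0.
have y2 : (2%:R * D * y - F) ^+ 2 = F ^+ 2 + 4%:R * genz K a z * D.
  by rewrite yE addrAC subrr add0r exprMn xx mul1r.
have D4 : 4%:R * D != 0 by rewrite mulf_neq0 // pnatr_eq0.
apply: (mulfI D4); apply/eqP; rewrite -subr_eq0.
have -> : 4%:R * D * (genz K a z + F * y) - 4%:R * D * (D * y ^+ 2)
    = (F ^+ 2 + 4%:R * genz K a z * D) - (2%:R * D * y - F) ^+ 2 by ring.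
by rewrite y2 subrr.
Qed.

Lemma omega_balance (R : realType) (a b cr d : int -> R) (K c : nat)
    (Rf : R[i] -> R[i]) (z : R[i]) (eta : R) (x : 'I_c -> R) (m' : 'I_c.+1) :
  (0 < c)%N ->
  (forall i, x i = 1 \/ x i = -1) -> - (c%:R)^-1 * \sum_(i < c) x i = eta ->
  genz K d z != 0 ->
  Rf z ^+ 2 = Ffun a b cr d K z ^+ 2 + 4%:R * genz K a z * genz K d z ->
  Sroot a b cr d K Rf eta z ->
  \sum_(m < c.+1) omega (fun i => beta_i a b cr d K Rf z (x i)) m
    * tridiag c (genz K a z) (genz K b z - z ^+ K * (gen1 K a + gen1 K b)%:C)
       (genz K cr z - z ^+ K * (gen1 K cr + gen1 K d)%:C) (genz K d z) m m' = 0.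
Proof.
move=> c0 hx heta D0 hR [_ hS].
pose bet i := beta_i a b cr d K Rf z (x i).
under eq_bigr do rewrite /omega -level_poly_coef.
apply: level_poly_tridiag => [i|].
  have := beta_i_root (hx i) D0 hR; rewrite -/(bet i) /Ffun => h.
  (* The sum of [Ffun] and the first diagonal parameter is the second one, which turns the quadratic
     equation into the hypothesis of [level_poly_tridiag]. *)
  transitivity (genz K a z + (z ^+ K * (gen1 K a + gen1 K b - gen1 K cr - gen1 K d)%:C
    - genz K b z + genz K cr z) * bet i
    + (genz K b z - z ^+ K * (gen1 K a + gen1 K b)%:C) * bet i).
    by rewrite !rmorphB !rmorphD /= -/(bet i); ring.
  by rewrite h -/(bet i); ring.
have two : 2%:R != 0 :> R[i] by rewrite pnatr_eq0.
have cn0 : c%:R != 0 :> R by rewrite pnatr_eq0 -lt0n.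
have sx : \sum_(i < c) x i = - c%:R * eta by rewrite -heta; field.
have term i : genz K d z * bet i + (genz K b z - z ^+ K * (gen1 K a + gen1 K b)%:C)
  = (Ffun a b cr d K z / 2%:R + (genz K b z - z ^+ K * (gen1 K a + gen1 K b)%:C))
    + Rf z / 2%:R * (x i)%:C.
  by rewrite /bet /beta_i; field; rewrite D0.
rewrite (eq_bigr _ (fun i _ => term i)) big_split /= sumr_const card_ord -mulr_sumr.
rewrite -rmorph_sum sx rmorphM rmorphN /= rmorph_nat -mulr_natr.
(* Since the signs sum to [- c * eta], what remains is [c / 2] times the difference of the two sides
   of (S_eta). *)
transitivity (c%:R / 2%:R * (genz K b z + genz K cr z
    - z ^+ K * (gen1 K a + gen1 K b + gen1 K cr + gen1 K d)%:C - eta%:C * Rf z)).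
  by rewrite /Ffun !rmorphB !rmorphD /=; field.
by rewrite -hS subrr mulr0.
Qed.

(** At 0, [Ffun] is c_K - b_K = 0 and the product of [genz K a] and [genz K d] is a_K d_K = 0, so
    [Rf] vanishes there and (S_eta) would force 2 b_K = 0. *)
Lemma Sroot_neq0 (R : realType) (a b cr d : int -> R) (K : nat)
    (Rf : R[i] -> R[i]) (eta : R) (z : R[i]) : (0 < K)%N ->
  a K%:Z = 0 \/ d K%:Z = 0 -> b K%:Z = cr K%:Z -> b K%:Z != 0 ->
  is_sqrt_branch a b cr d K Rf -> Sroot a b cr d K Rf eta z -> z != 0.
Proof.
move=> K0 had hbc b0 hR [z1 hS]; apply: contraNneq b0 => ze.
move: (hR z z1) hS; rewrite ze /Ffun !genz0 hbc expr0n eqn0Ngt K0 /= !mul0r.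
rewrite sub0r addNr expr0n /= add0r subr0.
have -> : 4%:R * (a K%:Z)%:C * (d K%:Z)%:C = 0.
  by case: had => ->; rewrite ?mulr0 ?mul0r.
move=> /eqP; rewrite sqrf_eq0 => /eqP -> /esym/eqP.
rewrite mulr0 -rmorphD /= -mulr2n => /eqP [/eqP].
by rewrite mulrn_eq0.
Qed.

(** * Summation over the roots of (S_eta) *)

Theorem theorem4 (R : realType) (c K : nat) (V : finType)
    (a b cr d : int -> R) (Rf : R[i] -> R[i]) (lam : nat -> R)
    (q : State c V -> State c V -> R) (p : State c V -> R)
    (kj : 'I_(K * c.+1) -> 'I_c.+1) (b0 : 'I_(K * c.+1) -> R[i])
    (x : 'I_(K * c.+1) -> 'I_c -> R) (gam : 'I_(K * c.+1) -> R[i])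
    (Fs : nat -> 'I_c.+1 -> R -> R) :
  (1 <= c)%N -> (1 <= K)%N ->
  (forall k : int, k <= K%:Z -> [/\ 0 <= a k, 0 <= b k, 0 <= cr k & 0 <= d k]) ->
  assumptionA a b cr d K ->
  ergodic_s a b cr d K ->
  is_sqrt_branch a b cr d K Rf ->
  assumptionBC a b cr d K c Rf ->
  assumptionD a b cr d K c lam ->
  sym_process a b cr d K q ->
  equilibrium q p ->
  (* (eta^(j), beta_{0,j}), j = 1..K(c+1), enumerate the pairs
     (eta, beta0) with eta = (c-2k)/c, beta0 a root of (S_eta), |beta0| < 1 *)
  (forall j, Sroot a b cr d K Rf (eta_of R c (kj j)) (b0 j)) ->
  injective (fun j => (kj j, b0 j)) ->
  (forall (k : 'I_c.+1) (z : R[i]), Sroot a b cr d K Rf (eta_of R c k) z ->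
     exists j, kj j = k /\ b0 j = z) ->
  (* x^(j) in {-1,1}^c with -(1/c) sum_i x^(j)_i = eta^(j) *)
  (forall j i, x j i = 1 \/ x j i = -1) ->
  (forall j, - (c%:R)^-1 * \sum_(i < c) x j i = eta_of R c (kj j)) ->
  (* the constants gamma_j *)
  (forall (n0 : nat) (m : 'I_c.+1),
     (pagg p n0 m)%:C =
     \sum_j gam j * b0 j ^+ n0
              * omega (fun i => beta_i a b cr d K Rf (b0 j) (x j i)) m) ->
  first_passage a b cr d K Fs ->
  forall t : R, 0 <= t ->
    let om j m := omega (fun i => beta_i a b cr d K Rf (b0 j) (x j i)) m in
    let u j n0 := \sum_(m < c.+1) b0 j ^+ n0 * om j m * (Fs n0 m t)%:C in
    (forall j, csummable (u j)) /\
    \sum_j gam j * cser (u j)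
    = \sum_j gam j * (\sum_(m < c.+1) om j m) / (1 - b0 j)
        * cexp (t%:C * \sum_(1 <= i < K.+1) (1 - (b0 j ^+ i)^-1) * (lam i)%:C).
Proof.
move=> c0 K0 _ hA _ hR hBC hD _ _ hS _ _ hx heta _ [F0 F0c F01 Fd] t t0 om u.
case: hA => summ _ _ had [hbc bK].
(* One limit per root yields both the summability and the value of its series. *)
suff main j : ctends (series (u j)) ((\sum_(m < c.+1) om j m) / (1 - b0 j)
    * cexp (t%:C * \sum_(1 <= i < K.+1) (1 - (b0 j ^+ i)^-1) * (lam i)%:C)).
  split=> [j|]; first by have [] := ctends_cser (main j).
  by apply: eq_bigr => j _; have [_ ->] := ctends_cser (main j); rewrite !mulrA.
have z1 : normc (b0 j) < 1 by have [h _] := hS j; rewrite normr_normc ltcR in h.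
have z0 : b0 j != 0 by exact: Sroot_neq0 K0 had hbc bK hR (hS j).
have [_ D0] := hBC _ _ (hS j).
have [B hB] := Lam_bounded c summ.
apply: (@level_series R K c.+1 (Lam a b cr d K c) (om j) (b0 j) lam B Fs) => //.
(* The balance series is a finite combination over [m] of the entrywise series of [Lam_ctends]; its
   sum vanishes by [omega_balance]. *)
- move=> m'; have [z1' _] := hS j.
  rewrite -(omega_balance m' c0 (hx j) (heta j) D0 (hR _ z1') (hS j)).
  have := ctends_sum (index_enum 'I_c.+1)
    (fun m => ctendsMl (om j m) (Lam_ctends summ z1 m m')).
  apply: (@eq_ctends _ _ _ _ 0%N) => N _.
  rewrite /series /balance_sum /level_row /=.
  under eq_bigr do rewrite mulr_sumr.
  rewrite exchange_big /=; apply: eq_bigr => n _; rewrite mulr_sumr.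
  by apply: eq_bigr => m _; ring.
- by move=> i /hD[].
- move=> n0 m s s0; have [ds es] := Fd n0 m s s0.
  by apply: DeriveDef => //; rewrite -derive1E.
Qed.
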